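(* Let $L>0$, $\lambda>6$, $a>0$, set $\kappa=\big(\frac{\lambda(\lambda+2)}4L^{-(2+\lambda)}\big)^{1/2}$, and let $v$ be a solution of the problem $$v_t+D^4v+D^2v=\tfrac12D(v^2),\qquad v(x,0)=v_0(x),\qquad B_0(v)=h(t)\ \text{ at } x=0 \text{ for } t>0,$$ such that $H_\lambda(v,L):=B_0(v)-C_\lambda(L)\ge-a^2$ for all $t>0$ for which the solution exists, and $$J_0:=\int_0^L v_0(x)|x-L|^\lambda\,dx>\frac a\kappa.$$ Then $v$ cannot be global in time: there is no global solution of this problem. Moreover, there is no global solution of this problem for $x\in(0,L)$, and, as long as the solution exists, $$J(t):=\int_0^L v(x,t)|x-L|^\lambda\,dx\ \ge\ \frac{1+c_0e^{2a\kappa t}}{1-c_0e^{2a\kappa t}}\,\frac a\kappa,\qquad c_0=\frac{\kappa J_0-a}{\kappa J_0+a},$$ and hence the blow-up time satisfies $$T_\infty<\frac1{2a\kappa}\ln\frac{\kappa J_0+a}{\kappa J_0-a}.$$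
   Context: Here $D=\partial/\partial x$, $\Omega=(0,L)$, and for $\lambda>6$, $L>0$: $$B_0(v)=-\tfrac12L^\lambda v^2(0,t)+\lambda L^{\lambda-1}\big[1+(\lambda-1)(\lambda-2)L^{-2}\big]v(0,t)+L^\lambda\big[1+\lambda(\lambda-1)L^{-2}\big]Dv(0,t)+\lambda L^{\lambda-1}D^2v(0,t)+L^\lambda D^3v(0,t),$$ $$C_\lambda(L)=\lambda(\lambda-1)^2L^{\lambda-6}\Big[\frac{(\lambda-2)^2(\lambda-3)^2}{\lambda-6}+\frac{2(\lambda-2)(\lambda-3)}{\lambda-4}L^2+\frac1{\lambda-2}L^4\Big].$$ A solution is understood in the weak sense: $v$ belongs to a function class in which the following makes sense, and for every $\psi\in C^4(\mathbb R)$, $$\frac{d}{dt}\int_\Omega v\psi\,dx+\int_\Omega v(D^4\psi+D^2\psi)\,dx=-\frac12\int_\Omega v^2D\psi\,dx+B(v,\psi),$$ $$B(v,\psi)=\Big[vD^3\psi-Dv\,D^2\psi+(D^2v+v)D\psi-(D^3v+Dv)\psi+\tfrac12v^2\psi\Big]_{x=0}^{x=L},$$ with initial data attained in the sense $\int_\Omega v(x,t)\psi(x)\,dx\to\int_\Omega v_0\psi\,dx$ as $t\to0$. The blow-up time $T_\infty$ is the supremum of times up to which the solution exists. *)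

(* Defs.v *)
From mathcomp Require Import all_boot all_order all_algebra.
From mathcomp Require Import all_classical all_reals all_analysis.
Import Order.TTheory GRing.Theory Num.Theory.
Import numFieldNormedType.Exports.

Set Implicit Arguments.
Unset Strict Implicit.
Unset Printing Implicit Defensive.

Local Open Scope classical_set_scope.
Local Open Scope ring_scope.

Section KuramotoSivashinsky.
Context {R : realType}.
Local Notation mu := (@lebesgue_measure R).
Implicit Types (L lam : R) (u psi h : R -> R) (v : R -> R -> R).

Definition C4 psi : Prop :=
  (forall k, (k < 4)%N -> forall x, derivable (derive1n k psi) x 1) /\
  continuous (derive1n 4 psi).

(* The boundary value of D^k u is its one-sided limit from inside (0, L):
   F is 0^'+ or L^'-, so the values of u outside (0, L) are irrelevant. *)
Definition trace (F : set_system R) u (k : nat) : R :=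
  lim (derive1n k u x @[x --> F]).

Definition has_traces (F : set_system R) u : Prop :=
  (forall k, (k < 3)%N -> \forall x \near F, derivable (derive1n k u) x 1) /\
  (forall k, (k <= 3)%N -> cvg (derive1n k u x @[x --> F])).

(* The class to which each v(., t) must belong for the weak formulation to
   make sense: L^2(0, L), with v, Dv, D^2 v, D^3 v having boundary values. *)
Definition admissible L u : Prop :=
  [/\ measurable_fun `]0, L[ u,
      mu.-integrable `]0, L[ (fun x => (u x ^+ 2)%:E),
      has_traces 0^'+ u & has_traces L^'- u].

(* The bracket of B(v, psi), at the end point p approached along F. *)
Definition bracket (F : set_system R) (p : R) u psi : R :=
  let d := trace F u in
  d 0%N * derive1n 3 psi p - d 1%N * derive1n 2 psi p + (d 2%N + d 0%N) * derive1n 1 psi p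
  - (d 3%N + d 1%N) * psi p + 2^-1 * d 0%N ^+ 2 * psi p.

Definition B L u psi : R := bracket L^'- L u psi - bracket 0^'+ 0 u psi.

Definition B0 lam L u : R :=
  let d := trace 0^'+ u in
  - 2^-1 * L `^ lam * d 0%N ^+ 2
  + lam * L `^ (lam - 1) * (1 + (lam - 1) * (lam - 2) * L ^- 2) * d 0%N
  + L `^ lam * (1 + lam * (lam - 1) * L ^- 2) * d 1%N
  + lam * L `^ (lam - 1) * d 2%N
  + L `^ lam * d 3%N.

Definition Clam lam L : R :=
  lam * (lam - 1) ^+ 2 * L `^ (lam - 6) *
  ((lam - 2) ^+ 2 * (lam - 3) ^+ 2 / (lam - 6)
   + 2 * (lam - 2) * (lam - 3) / (lam - 4) * L ^+ 2
   + (lam - 2)^-1 * L ^+ 4).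

Definition Hlam lam L u : R := B0 lam L u - Clam lam L.

Definition kappa lam L : R :=
  Num.sqrt (lam * (lam + 2) / 4 * L `^ (- (2 + lam))).

Definition moment lam L u : R := \int[mu]_(x in `]0, L[) (u x * `|x - L| `^ lam).

Definition weak_equation_at L v (t : R) psi : Prop :=
  let I s := \int[mu]_(x in `]0, L[) (v x s * psi x) in
  derivable I t 1 /\
  derive1 I t + \int[mu]_(x in `]0, L[) (v x t * (derive1n 4 psi x + derive1n 2 psi x)) =
  - 2^-1 * \int[mu]_(x in `]0, L[) (v x t ^+ 2 * derive1n 1 psi x) + B L (v ^~ t) psi.

Definition weak_solution lam L (v0 : R -> R) h (T : \bar R) v : Prop :=
  [/\ forall t, 0 < t -> (t%:E < T)%E -> admissible L (v ^~ t),
      forall psi, C4 psi ->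
        forall t, 0 < t -> (t%:E < T)%E -> weak_equation_at L v t psi,
      forall psi, C4 psi ->
        \int[mu]_(x in `]0, L[) (v x t * psi x) @[t --> 0^'+] -->
        \int[mu]_(x in `]0, L[) (v0 x * psi x)
    & forall t, 0 < t -> (t%:E < T)%E -> B0 lam L (v ^~ t) = h t].

(* T = +oo is allowed, so that blowup_time = +oo for a global solution. *)
Definition blowup_time lam L (v0 : R -> R) h v : \bar R :=
  ereal_sup [set T | (0 < T)%E /\ weak_solution lam L v0 h T v].

End KuramotoSivashinsky.

(* Main.v *)
Require Import Defs.
From mathcomp Require Import all_boot all_order all_algebra.
From mathcomp Require Import all_classical all_reals all_analysis.
From mathcomp Require Import measurable_realfun.
From mathcomp Require Import ring lra.
Import Order.TTheory GRing.Theory Num.Theory.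
Import numFieldNormedType.Exports.
Local Open Scope classical_set_scope.
Local Open Scope ring_scope.

(** The proof is the method of nonlinear capacity: the weak equation is tested
    against one weight, and the resulting moment J obeys a Riccati inequality.

    Take psi = (L - x)^lam on (0, L), continued by 0 beyond L. It is of class
    C^4 ([C4_cutpow]), it vanishes at L with its first three derivatives, and the
    bracket at 0 contributes exactly B0 ([B_cutpow]). With y = L - x, the weak equation
    becomes
      J' = lam/2 int v^2 y^(lam-1) - int v (D^4 psi + D^2 psi) + B0(v).
    The middle term is absorbed by Young's inequality at the cost of Clam, and
    the remaining half of the quadratic term dominates (kappa J)^2 by the
    Cauchy-Schwarz inequality. Hence J' >= (kappa J)^2 + B0 - Clam
    >= (kappa J)^2 - a^2.

    The blow-up bound is strict while the lifespan is a supremum, so the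
    Riccati inequality is needed in strict form. It does hold strictly
    ([energy_gap]), because the equality cases of the Young and Cauchy-Schwarz
    inequalities are incompatible; a single completed square, nonnegative for
    every value of a parameter al ([square_completion]), delivers both
    inequalities together with a positive remainder.

    For a function with J' > (kappa J)^2 - a^2 and kappa J(0) > a, first
    kappa J stays above a ([riccati_gt]); then
      W(t) = (kappa J - a) / (kappa J + a) exp(-2 a kappa t)
    increases strictly from W(0) = c0. The inequality c0 < W(t) is the lower
    bound for J ([riccati_lower_bound]); W(t) < exp(-2 a kappa t) bounds the
    lifespan, and starting from W at a later time, where it already exceeds c0,
    makes that bound strict ([riccati_blowup]). *)

(** * The test function *)

(** On (0, L) this is |x - L|^p; cutting it off to 0 beyond L keeps the
    derivatives of order below p in the same family up to constants. *)
Definition cutpow {R : realType} (L p x : R) : R := Num.max 0 (L - x) `^ p.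

Section TestFunction.
Set Implicit Arguments.
Unset Strict Implicit.
Variables (R : realType) (L : R).
Implicit Types p x : R.

Lemma is_derive_continuous (f : R -> R) x df : is_derive x 1 f df -> {for x, continuous f}.
Proof. by case=> D _; apply: differentiable_continuous; exact/derivable1_diffP. Qed.

Lemma cutpow_lt p x : x < L -> cutpow L p x = (L - x) `^ p.
Proof. by move=> xL; rewrite /cutpow max_r// subr_ge0 ltW. Qed.

Lemma cutpow_ge p x : L <= x -> 0 < p -> cutpow L p x = 0.
Proof. by move=> xL p0; rewrite /cutpow max_l ?subr_le0// powR0// gt_eqF. Qed.

Lemma is_derive_sub_powR p x : x < L ->
  is_derive x 1 (fun y => (L - y) `^ p) (- p * (L - x) `^ (p - 1)).
Proof.
move=> xL; have Lx : 0 < L - x by rewrite subr_gt0.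
have D1 : is_derive x 1 (fun y => L - y) (-1).
  by rewrite -[X in is_derive _ _ _ X]sub0r; exact: is_deriveB.
have D2 := is_derive1_powR p Lx.
have H := is_derive1_comp (f := fun u : R => u `^ p) (g := fun y => L - y) D2 D1.
rewrite (_ : - p * _ = p * (L - x) `^ (p - 1) * -1); first exact: H.
by rewrite mulrN1 mulNr.
Qed.

(** At x = L the difference quotient is bounded by |h|^(p - 1), which tends
    to 0 because p > 1. *)
Lemma is_derive_cutpow p x : 1 < p ->
  is_derive x 1 (cutpow L p) (- p * cutpow L (p - 1) x).
Proof.
move=> p1; have p0 : 0 < p by lra.
have p10 : 0 < p - 1 by lra.
have [xL|xL|->] := ltgtP x L.
- rewrite (cutpow_lt _ xL).
  apply: near_eq_is_derive (is_derive_sub_powR p xL).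
  by near=> y; rewrite cutpow_lt//; near: y; exact: lt_nbhsl.
- rewrite (cutpow_ge (ltW xL))// mulr0.
  apply: (@near_eq_is_derive _ _ _ (cst 0)).
  by near=> y; rewrite cutpow_ge// ltW//; near: y; exact: lt_nbhsr.
- rewrite (cutpow_ge (lexx L))// mulr0.
  have H : h^-1 *: (cutpow L p (h *: 1 + L) - cutpow L p L) @[h --> 0^'] --> (0 : R).
    apply/cvgrPdist_le => e e0.
    near=> h.
    rewrite sub0r normrN [cutpow L p L]cutpow_ge// subr0.
    have h0 : h != 0 by near: h; exact: nbhs_dnbhs_neq.
    rewrite /GRing.scale/= mulr1 normrM normfV /cutpow.
    rewrite (_ : L - (h + L) = - h); last by ring.
    have nh0 : 0 < `|h| by rewrite normr_gt0.
    have hp : `|h| `^ (p - 1) <= e.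
      have he : `|h| <= e `^ (p - 1)^-1.
        near: h; apply: dnbhs0_le; exact: powR_gt0.
      have := ge0_ler_powR (ltW p10) _ _ he.
      rewrite !nnegrE powR_ge0 -powRrM mulVf ?gt_eqF// powRr1 ?(ltW e0)//.
      by apply; rewrite // ltW.
    apply: le_trans hp.
    rewrite ler_pdivrMl// mulr_powRB1 ?(ltW p0)// ger0_norm ?powR_ge0//.
    have hle : Num.max 0 (- h) <= `|h| by rewrite ge_max normr_ge0/= -normrN ler_norm.
    by have := ge0_ler_powR (ltW p0) _ _ hle; rewrite !nnegrE le_max lexx; apply.
  split.
    by apply/cvg_ex; exists 0.
  exact: cvg_lim H.
Unshelve. all: by end_near. Qed.

Lemma continuous_cutpow p : 1 < p -> continuous (cutpow L p).
Proof. by move=> p1 x; exact: is_derive_continuous (is_derive_cutpow x p1). Qed.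

Lemma derive1n_cutpow p n : n%:R < p ->
  derive1n n (cutpow L p) =
  fun x => (\prod_(i < n) (i%:R - p)) * cutpow L (p - n%:R) x.
Proof.
elim: n => [_|n IHn np]; first by apply/funext => x; rewrite derive1n0 big_ord0 mul1r subr0.
have n1p : n%:R + 1 < p by rewrite natr1.
rewrite derive1nS IHn; last by lra.
apply/funext => x; rewrite derive1E.
have D := is_derive_cutpow x (p := p - n%:R) ltac:(lra).
rewrite deriveZ; last by case: D.
rewrite derive_val big_ord_recr/= -mulrA; congr (_ * _).
by rewrite -natr1 opprB opprD addrA.
Qed.

Lemma C4_cutpow p : 5 < p -> C4 (cutpow L p).
Proof.
move=> p5; split.
  move=> k k4 x; have k4' : k%:R <= 3 :> R by rewrite ler_nat.
  rewrite derive1n_cutpow; last by lra.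
  apply: derivableM => //.
  by case: (is_derive_cutpow x (p := p - k%:R) ltac:(lra)).
rewrite derive1n_cutpow; last by lra.
move=> x; apply: cvgM; first exact: cvg_cst.
by apply: continuous_cutpow; lra.
Qed.

End TestFunction.

(** * Integrals of powers of L - x *)

Section PowerIntegral.
Set Implicit Arguments.
Unset Strict Implicit.
Variables (R : realType) (L : R).
Hypothesis L_gt0 : 0 < L.
Local Notation mu := (@lebesgue_measure R).
Implicit Types p x : R.

(** The value of the integral of (L - x)^p over (0, L). *)
Definition intpow p : R := (p + 1)^-1 * L `^ (p + 1).

Lemma integral_sub_powR_cc (b : R) p : 0 < b -> b < L -> -1 < p ->
  (\int[mu]_(x in `[0%R, b]) ((L - x) `^ p)%:E =
   ((p + 1)^-1 * (L `^ (p + 1) - (L - b) `^ (p + 1)))%:E)%E.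
Proof.
move=> b0 bL p1.
have p10 : p + 1 != 0 by apply: lt0r_neq0; lra.
pose F x := - (p + 1)^-1 * (L - x) `^ (p + 1).
have dF x : x < L -> is_derive x 1 F ((L - x) `^ p).
  move=> xL; have := is_derive_sub_powR (p + 1) xL; rewrite addrK => D.
  rewrite (_ : (L - x) `^ p = - (p + 1)^-1 *: (- (p + 1) * (L - x) `^ p)).
    exact: is_deriveZ.
  by rewrite /GRing.scale/= mulrA mulrNN mulVf// mul1r.
have cf x : x < L -> {for x, continuous (fun x => (L - x) `^ p)}.
  by move=> xL; exact: is_derive_continuous (is_derive_sub_powR p xL).
rewrite (@continuous_FTC2 _ _ F)//.
- rewrite /F subr0 -EFinB; congr (_%:E); ring.
- apply: continuous_in_subspaceT => x; rewrite inE/= in_itv/= => /andP[_ xb].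
  by apply: cf; apply: le_lt_trans bL.
- split.
  + move=> x; rewrite in_itv/= => /andP[_ xb].
    by case: (dF x (lt_trans xb bL)).
  + by apply: cvg_at_right_filter; exact: is_derive_continuous (dF _ L_gt0).
  + by apply: cvg_at_left_filter; exact: is_derive_continuous (dF _ bL).
- move=> x; rewrite in_itv/= => /andP[_ xb]; rewrite derive1E.
  by have := dF x (lt_trans xb bL) => D; rewrite derive_val.
Qed.

Lemma measurable_sub_powR p (D : set R) : measurable_fun D (fun x => (L - x) `^ p).
Proof.
apply: measurable_funTS.
apply: (@measurableT_comp _ _ _ _ _ _ (fun x => x `^ p)) => //.
exact: measurable_funB.
Qed.

(** For p < 0 the integrand is unbounded near x = L, so the fundamental theorem
    is applied on [0, b] for b below L, and b tends to L by monotone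
    convergence. Negative exponents down to -1 are needed because lambda - 7
    occurs below. *)
Lemma ge0_integral_sub_powR p : -1 < p ->
  (\int[mu]_(x in `]0%R, L[) ((L - x) `^ p)%:E = (intpow p)%:E)%E.
Proof.
move=> p1; have p10 : 0 < p + 1 by lra.
have mf (D : set R) : measurable_fun D (fun x => ((L - x) `^ p)%:E).
  by apply/measurable_EFinP; exact: measurable_sub_powR.
rewrite integral_itv_obnd_cbnd//.
pose r n : R := n.+2%:R^-1.
have r0 n : 0 < r n by rewrite invr_gt0 ltr0n.
have r1 n : r n < 1 by rewrite invf_lt1 ?ltr0n// ltr1n.
have rcvg : r @ \oo --> (0 : R).
  by have := @cvg_harmonic R; rewrite -(cvg_shiftS _).
pose b n := L - L * r n.
have b0 n : 0 < b n by rewrite subr_gt0 gtr_pMr.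
have bL n : b n < L by rewrite ltrBlDr ltrDl mulr_gt0.
have Ecup : \bigcup_n `[0, b n]%classic = `[0, L[%classic.
  apply/seteqP; split => x /=.
    by move=> [n _ /=]; rewrite !in_itv/= => /andP[-> xb]; apply: le_lt_trans (bL n).
  rewrite in_itv/= => /andP[x0 xL].
  have /(cvgr_lt _ rcvg)[n _ /(_ n (leqnn n)) rn] : 0 < (L - x) / L.
    by rewrite divr_gt0// subr_gt0.
  exists n => //=; rewrite in_itv/= x0/= /b.
  by move: rn; rewrite ltr_pdivlMr//= => rn; rewrite lerBrDr addrC -lerBrDr mulrC ltW.
rewrite -Ecup; apply/esym.
have ndF : nondecreasing_seq (fun n => `[0, b n]%classic).
  apply/nondecreasing_seqP => n; rewrite subsetEset => x /=; rewrite !in_itv/=.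
  move=> /andP[-> xb]; rewrite (le_trans xb)//= lerD2l lerN2 ler_pM2l//.
  by rewrite lef_pV2 ?posrE ?ltr0n// ler_nat.
have : (\int[mu]_(x in `[0%R, b n]) ((L - x) `^ p)%:E @[n --> \oo] -->
    \int[mu]_(x in \bigcup_n `[0%R, b n]%classic) ((L - x) `^ p)%:E)%E.
  apply: ge0_nondecreasing_set_cvg_integral => //; first by move=> n; exact: mf.
  by move=> n x _; rewrite lee_fin powR_ge0.
rewrite (eq_cvg _ _ (fun n => integral_sub_powR_cc (b0 n) (bL n) p1)).
move/(cvg_lim (@ereal_hausdorff R)) => <-; apply/esym/cvg_lim => //.
apply: cvg_EFin; first by near=> n.
apply: cvgMr; rewrite -[X in _ --> X]subr0; apply: cvgB; first exact: cvg_cst.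
rewrite /b; under eq_fun do rewrite opprB addrCA subrr addr0.
apply: cvg_comp (powR_cvg0 p10).
have : L * r n @[n --> \oo] --> (0 : R) by rewrite -(mulr0 L); exact: cvgMr.
move=> Lr A A0.
have rA : \forall n \near \oo, 0 < L * r n -> A (L * r n) := Lr _ A0.
by change (\forall n \near \oo, A (L * r n)); apply: filterS rA => n; apply; rewrite mulr_gt0.
Unshelve. all: by end_near. Qed.

Lemma integrable_sub_powR p : -1 < p ->
  mu.-integrable `]0, L[ (EFin \o (fun x => (L - x) `^ p)).
Proof.
move=> p1; apply/integrableP; split.
  by apply/measurable_EFinP; exact: measurable_sub_powR.
under eq_integral do rewrite /= ger0_norm ?powR_ge0//.
by rewrite ge0_integral_sub_powR// ltry.
Qed.

Lemma Rintegral_sub_powR p : -1 < p ->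
  \int[mu]_(x in `]0, L[) ((L - x) `^ p) = intpow p.
Proof. by move=> p1; rewrite /Rintegral ge0_integral_sub_powR. Qed.

End PowerIntegral.

(** * Integrability against a square-integrable function *)

Section EnergyInequality.
Set Implicit Arguments.
Unset Strict Implicit.
Variables (R : realType) (L : R).
Hypothesis L_gt0 : 0 < L.
Local Notation mu := (@lebesgue_measure R).
Local Notation D := (`]0, L[%classic : set R).
Implicit Types (p lam I : R) (u f : R -> R).

(** Integrability and the value are kept together, so that the integral of a
    linear combination is read off from its terms without reproving
    integrability at each step. *)
Definition has_Rintegral f I : Prop :=
  mu.-integrable D (EFin \o f) /\ \int[mu]_(x in D) f x = I.

Lemma has_RintegralD f g I I' : has_Rintegral f I -> has_Rintegral g I' ->
  has_Rintegral (fun x => f x + g x) (I + I').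
Proof.
move=> [fi <-] [gi <-]; split; last exact: RintegralD.
by apply: eq_integrable (integrableD _ fi gi).
Qed.

Lemma has_RintegralZ c f I : has_Rintegral f I -> has_Rintegral (fun x => c * f x) (c * I).
Proof.
move=> [fi <-]; split; last exact: RintegralZl.
by apply: eq_integrable (integrableZl _ c fi).
Qed.

Lemma eq_has_Rintegral g f I : (forall x, 0 < x < L -> f x = g x) ->
  has_Rintegral f I -> has_Rintegral g I.
Proof.
move=> fg [fi <-].
have fgD : {in D, f =1 g} by move=> x; rewrite inE/= in_itv/= => /fg.
split; last by apply/esym/eq_Rintegral.
by apply: eq_integrable fi => // x xD /=; rewrite fgD.
Qed.

Lemma has_Rintegral_sub_powR p : -1 < p ->
  has_Rintegral (fun x => (L - x) `^ p) (intpow L p).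
Proof. by move=> p1; split; [exact: integrable_sub_powR|exact: Rintegral_sub_powR]. Qed.

Section Square_integrable.
Variable u : R -> R.
Hypotheses (mu_u : measurable_fun D u)
           (u2_int : mu.-integrable D (fun x => (u x ^+ 2)%:E)).

Lemma sub_powR_le p x : 0 <= p -> 0 < x < L -> (L - x) `^ p <= L `^ p.
Proof.
move=> p0 /andP[x0 xL].
have h : L - x <= L by lra.
by have := ge0_ler_powR p0 _ _ h; rewrite !nnegrE subr_ge0 ltW// ltW//; apply.
Qed.

Lemma integrable_sqr_mul_powR p : 0 <= p ->
  mu.-integrable D (EFin \o (fun x => u x ^+ 2 * (L - x) `^ p)).
Proof.
move=> p0.
have i2 : mu.-integrable D (fun x => ((L `^ p)%:E * (u x ^+ 2)%:E)%E) by exact: integrableZl.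
apply: (le_integrable _ _ _ i2) => //.
- apply/measurable_EFinP; apply: measurable_funM; last exact: measurable_sub_powR.
  exact: measurable_funX.
- move=> x; rewrite /= in_itv/= => xL; rewrite lee_fin.
  have h : `|u x ^+ 2 * (L - x) `^ p| <= `|L `^ p * u x ^+ 2|.
    rewrite [L `^ p * _]mulrC (normrM (u x ^+ 2)) (normrM (u x ^+ 2)).
    by rewrite ler_wpM2l// !ger0_norm ?powR_ge0// sub_powR_le.
  exact: h.
Qed.

(** Domination by L^p (1 + u^2), since |u| <= 1 + u^2. *)
Lemma integrable_mul_powR p : 0 <= p ->
  mu.-integrable D (EFin \o (fun x => u x * (L - x) `^ p)).
Proof.
move=> p0.
have [i1 _] := has_RintegralZ (L `^ p) (has_Rintegral_sub_powR (p := 0) ltac:(lra)).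
have i2 : mu.-integrable D (fun x => ((L `^ p)%:E * (u x ^+ 2)%:E)%E) by exact: integrableZl.
apply: (le_integrable _ _ _ (integrableD _ i1 i2)) => //.
- apply/measurable_EFinP; apply: measurable_funM => //; exact: measurable_sub_powR.
- move=> x; rewrite /= in_itv/= => xL; rewrite lee_fin powRr0 mulr1.
  have h : `|u x * (L - x) `^ p| <= `|L `^ p + L `^ p * u x ^+ 2|.
    have h0 : 0 <= (L - x) `^ p by exact: powR_ge0.
    have h1 : 0 <= L `^ p by exact: powR_ge0.
    rewrite normrM (ger0_norm h0) -[X in _ <= `|X + _|]mulr1 -mulrDr normrM (ger0_norm h1).
    rewrite mulrC ler_pM// ?sub_powR_le// [leRHS]ger0_norm ?addr_ge0 ?sqr_ge0//.
    rewrite -(real_normK (num_real (u x))).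
    have := sqr_ge0 (`|u x| - 2^-1); nra.
  exact: h.
Qed.

End Square_integrable.
End EnergyInequality.

(** * The energy inequality *)

Section Energy.
Set Implicit Arguments.
Unset Strict Implicit.
Variables (R : realType) (L lam : R).
Local Notation mu := (@lebesgue_measure R).
Local Notation D := (`]0, L[%classic : set R).
Implicit Types (p I : R) (u f : R -> R).

Lemma powRDn (x p q : R) n : 0 < x -> q = p + n%:R -> x `^ q = x `^ p * x ^+ n.
Proof.
move=> x0 ->; rewrite powRD ?powR_mulrn ?(ltW x0)//.
by apply/implyP => _; rewrite gt_eqF.
Qed.

(** With y = L - x, the right-hand side is the integral of
    (u - al y - (lam - 1)(A y^-3 + y^-1))^2 y^(lam - 1), expanded.
    With al = 0 this is Young's inequality, with al y as the only correction it
    is the Cauchy-Schwarz inequality for J; having both corrections in one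
    square is what makes the next lemma strict. *)
Lemma square_completion u (al : R) (A := (lam - 2) * (lam - 3))
  (X := \int[mu]_(x in D) (u x ^+ 2 * (L - x) `^ (lam - 1)))
  (Y1 := \int[mu]_(x in D) (u x * (L - x) `^ (lam - 4)))
  (Y2 := \int[mu]_(x in D) (u x * (L - x) `^ (lam - 2)))
  (J := \int[mu]_(x in D) (u x * (L - x) `^ lam)) :
  0 < L -> 6 < lam ->
  measurable_fun D u -> mu.-integrable D (fun x => (u x ^+ 2)%:E) ->
  0 <= X + ((- 2 * al) * J + ((- 2 * (lam - 1) * A) * Y1 + (- 2 * (lam - 1)) * Y2))
   + (al ^+ 2 * intpow L (lam + 1)
      + (2 * al * (lam - 1) * A * intpow L (lam - 3) + 2 * al * (lam - 1) * intpow L (lam - 1)))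
   + ((lam - 1) ^+ 2 * A ^+ 2 * intpow L (lam - 7)
      + (2 * (lam - 1) ^+ 2 * A * intpow L (lam - 5) + (lam - 1) ^+ 2 * intpow L (lam - 3))).
Proof.
move=> L_gt0 lam_gt6 mu_u u2.
have hp p : -1 < p -> has_Rintegral L (fun x => (L - x) `^ p) (intpow L p).
  exact: has_Rintegral_sub_powR.
have hu p : 0 <= p -> has_Rintegral L (fun x => u x * (L - x) `^ p)
    (\int[mu]_(x in D) (u x * (L - x) `^ p)).
  by move=> p0; split => //; exact: integrable_mul_powR.
have [l0 [l1 [l2 l4]]] : 0 <= lam /\ 0 <= lam - 1 /\ 0 <= lam - 2 /\ 0 <= lam - 4 by do !split; lra.
have [k1 [k3 [k5 [k7 k0]]]] : -1 < lam - 1 /\ -1 < lam - 3 /\ -1 < lam - 5 /\ -1 < lam - 7 /\ -1 < lam + 1.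
  by do !split; lra.
have hX : has_Rintegral L (fun x => u x ^+ 2 * (L - x) `^ (lam - 1)) X.
  by split => //; exact: integrable_sqr_mul_powR.
(* The square is multiplied out with y^6 moved inside, so that no negative
   power of y other than possibly y^(lam - 7) remains. *)
have /(@eq_has_Rintegral _ _ (fun x => (u x * (L - x) ^+ 3 - al * (L - x) ^+ 4
    - (lam - 1) * (A + (L - x) ^+ 2)) ^+ 2 * (L - x) `^ (lam - 7))) := 
  has_RintegralD (has_RintegralD
   (has_RintegralD hX (has_RintegralD (has_RintegralZ (- 2 * al) (hu _ l0))
     (has_RintegralD (has_RintegralZ (- 2 * (lam - 1) * A) (hu _ l4))
                     (has_RintegralZ (- 2 * (lam - 1)) (hu _ l2)))))
   (has_RintegralD (has_RintegralZ (al ^+ 2) (hp _ k0))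
     (has_RintegralD (has_RintegralZ (2 * al * (lam - 1) * A) (hp _ k3))
        (has_RintegralZ (2 * al * (lam - 1)) (hp _ k1)))))
   (has_RintegralD (has_RintegralZ ((lam - 1) ^+ 2 * A ^+ 2) (hp _ k7))
     (has_RintegralD (has_RintegralZ (2 * (lam - 1) ^+ 2 * A) (hp _ k5))
        (has_RintegralZ ((lam - 1) ^+ 2) (hp _ k3)))).
case.
  move=> x /andP[x0 xL]; have y0 : 0 < L - x by rewrite subr_gt0.
  rewrite (@powRDn _ (lam - 7) (lam - 5) 2 y0); last by ring.
  rewrite (@powRDn _ (lam - 7) (lam - 4) 3 y0); last by ring.
  rewrite (@powRDn _ (lam - 7) (lam - 3) 4 y0); last by ring.
  rewrite (@powRDn _ (lam - 7) (lam - 2) 5 y0); last by ring.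
  rewrite (@powRDn _ (lam - 7) (lam - 1) 6 y0); last by ring.
  rewrite (@powRDn _ (lam - 7) lam 7 y0); last by ring.
  rewrite (@powRDn _ (lam - 7) (lam + 1) 8 y0); last by ring.
  by ring.
move=> _ <-; apply: Rintegral_ge0 => x _.
by rewrite mulr_ge0 ?sqr_ge0 ?powR_ge0.
Qed.

Lemma kappa_sqr : 6 < lam -> kappa lam L ^+ 2 = lam / 4 / intpow L (lam + 1).
Proof.
move=> lam_gt6.
rewrite sqr_sqrtr; last first.
  by rewrite mulr_ge0 ?powR_ge0// divr_ge0// mulr_ge0; lra.
rewrite powRN /intpow invfM invrK (_ : lam + 1 + 1 = 2 + lam); last by ring.
by ring.
Qed.

(** The constants Clam and kappa^2 come from Young's inequality and from the
    Cauchy-Schwarz inequality separately. Equality in the first forces u to be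
    a combination of y^-3 and y^-1, equality in the second forces u to be a
    multiple of y = L - x, so the two cannot be sharp together. In numbers:
    minimizing the completed square over al leaves a surplus proportional to
    (J - 2 q)^2 + 2 (P S - q^2), and q^2 < P S is the strict Cauchy-Schwarz
    inequality between these two extremal functions. *)
Lemma energy_gap u
  (X := \int[mu]_(x in D) (u x ^+ 2 * (L - x) `^ (lam - 1)))
  (Y1 := \int[mu]_(x in D) (u x * (L - x) `^ (lam - 4)))
  (Y2 := \int[mu]_(x in D) (u x * (L - x) `^ (lam - 2)))
  (J := \int[mu]_(x in D) (u x * (L - x) `^ lam)) :
  0 < L -> 6 < lam ->
  measurable_fun D u -> mu.-integrable D (fun x => (u x ^+ 2)%:E) ->
  (kappa lam L * J) ^+ 2 <
  lam / 2 * X - lam * (lam - 1) * ((lam - 2) * (lam - 3) * Y1 + Y2) + Clam lam L.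
Proof.
move=> L_gt0 lam_gt6 mu_u u2.
have N0 : 0 < L `^ (lam - 6) by exact: powR_gt0.
pose A : R := (lam - 2) * (lam - 3).
pose P := intpow L (lam + 1).
pose q := (lam - 1) * (A * intpow L (lam - 3) + intpow L (lam - 1)).
pose S := (lam - 1) ^+ 2 * (A ^+ 2 * intpow L (lam - 7) + 2 * A * intpow L (lam - 5) + intpow L (lam - 3)).
have A0 : 0 < A by rewrite mulr_gt0; lra.
have EL n p : p + 1 = lam - 6 + n%:R -> intpow L p = L `^ (lam - 6) * L ^+ n / (lam - 6 + n%:R).
  by move=> E; rewrite /intpow (powRDn L_gt0 E) E mulrC.
have EP : P = L `^ (lam - 6) * L ^+ 8 / (lam + 2).
  by rewrite /P (@EL 8); [congr (_ / _); ring|ring].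
have E1 : intpow L (lam - 1) = L `^ (lam - 6) * L ^+ 6 / lam.
  by rewrite (@EL 6); [congr (_ / _); ring|ring].
have E3 : intpow L (lam - 3) = L `^ (lam - 6) * L ^+ 4 / (lam - 2).
  by rewrite (@EL 4); [congr (_ / _); ring|ring].
have E5 : intpow L (lam - 5) = L `^ (lam - 6) * L ^+ 2 / (lam - 4).
  by rewrite (@EL 2); [congr (_ / _); ring|ring].
have E7 : intpow L (lam - 7) = L `^ (lam - 6) / (lam - 6).
  by rewrite (@EL 0); [rewrite expr0 mulr1 addr0|ring].
have P0 : 0 < P.
  by rewrite EP !mulr_gt0 ?exprn_gt0 ?invr_gt0//; lra.
have ES : Clam lam L = lam * S.
  by rewrite /Clam /S E7 E5 E3 /A; ring.
(* Both sides are quadratic in A and L^2; they compare coefficient by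
   coefficient, through the denominators. *)
have PS : q ^+ 2 < P * S.
  pose c := (lam - 1) ^+ 2 * (L `^ (lam - 6)) ^+ 2 * L ^+ 8.
  have c0 : 0 < c by rewrite !mulr_gt0 ?exprn_gt0//; lra.
  have -> : q ^+ 2 = c * (A ^+ 2 * ((lam - 2) ^+ 2)^-1 + 2 * A * L ^+ 2 * (lam * (lam - 2))^-1
      + L ^+ 4 * (lam ^+ 2)^-1).
    by rewrite /q E3 E1 /c; field; apply/andP; split; apply: lt0r_neq0; lra.
  have -> : P * S = c * (A ^+ 2 * ((lam + 2) * (lam - 6))^-1
      + 2 * A * L ^+ 2 * ((lam + 2) * (lam - 4))^-1 + L ^+ 4 * ((lam + 2) * (lam - 2))^-1).
    rewrite /S EP E3 E5 E7 /c; field.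
    by do ?[apply/andP; split]; apply: lt0r_neq0; lra.
  rewrite ltr_pM2l//.
  have inv (c1 c2 : R) : 0 < c1 -> c1 < c2 -> c2^-1 < c1^-1.
    by move=> a0 ab; rewrite ltf_pV2// posrE (lt_trans a0).
  have A2 : 0 < A ^+ 2 by exact: exprn_gt0.
  have AL : 0 < 2 * A * L ^+ 2 by rewrite (mulr_gt0 (mulr_gt0 _ A0)) ?exprn_gt0.
  have L4 : 0 < L ^+ 4 by exact: exprn_gt0.
  apply: ltrD; first apply: ltrD.
  - by rewrite (ltr_pM2l A2); apply: inv; nra.
  - by rewrite (ltr_pM2l AL); apply: inv; nra.
  - by rewrite (ltr_pM2l L4); apply: inv; nra.
(* (J - q) / P is the minimizer of the quadratic polynomial in al. *)
have H := square_completion ((J - q) / P) L_gt0 lam_gt6 mu_u u2; rewrite -/X -/Y1 -/Y2 -/J -/P -/A in H.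
have {H} H : 0 <= X - 2 * ((lam - 1) * (A * Y1 + Y2)) - (J - q) ^+ 2 / P + S.
  apply: le_trans H _; rewrite le_eqVlt; apply/orP; left; apply/eqP.
  by rewrite /S /q; field; exact: lt0r_neq0.
rewrite exprMn kappa_sqr// -/P ES -/A.
have H2 : lam / 2 * ((J - q) ^+ 2 / P - S) <= lam / 2 * (X - 2 * ((lam - 1) * (A * Y1 + Y2))).
  by rewrite ler_pM2l; [lra|lra].
have H3 : lam / 4 / P * J ^+ 2 < lam / 2 * ((J - q) ^+ 2 / P + S).
  rewrite -subr_gt0 (_ : _ - _ = lam / 4 / P * ((J - 2 * q) ^+ 2 + 2 * (P * S - q ^+ 2))).
    by rewrite mulr_gt0// ?divr_gt0//; [lra|have := sqr_ge0 (J - 2 * q); lra].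
  by field; exact: lt0r_neq0.
lra.
Qed.

End Energy.

(** * Differential inequality for the moment *)

Section Weak.
Set Implicit Arguments.
Unset Strict Implicit.
Variables (R : realType) (L lam : R).
Local Notation mu := (@lebesgue_measure R).
Local Notation D := (`]0, L[%classic : set R).
Implicit Types (p I t : R) (u f : R -> R).

Lemma Rintegral_mul_cutpow p u :
  \int[mu]_(x in D) (u x * cutpow L p x) = \int[mu]_(x in D) (u x * (L - x) `^ p).
Proof.
apply: eq_Rintegral => x; rewrite inE/= in_itv/= => /andP[_ xL].
by rewrite cutpow_lt.
Qed.

Lemma momentE u : moment lam L u = \int[mu]_(x in D) (u x * cutpow L lam x).
Proof.
apply: eq_Rintegral => x; rewrite inE/= in_itv/= => /andP[_ xL].
by rewrite cutpow_lt// distrC ger0_norm// subr_ge0 ltW.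
Qed.

Let prodE := (big_ord_recr, big_ord0).

(** The test function and its first three derivatives vanish at L, so only the
    end point 0 contributes, and there the bracket is the prescribed combination B0. *)
Lemma B_cutpow u : 0 < L -> 6 < lam -> B L u (cutpow L lam) = B0 lam L u.
Proof.
move=> L0 l6.
have l4 n : (n <= 4)%N -> n%:R < lam.
  by move=> n4; apply: le_lt_trans (_ : 4 < _); [rewrite ler_nat|lra].
have l4' n : (n <= 4)%N -> 0 < lam - n%:R by move/l4; rewrite subr_gt0.
have z0 : cutpow L lam L = 0 by rewrite cutpow_ge//; have := l4 0%N isT.
rewrite /B /bracket z0 !derive1n_cutpow ?l4//.
rewrite !(cutpow_ge (lexx L) (l4' _ _))//.
rewrite !(cutpow_lt _ L0) subr0 /B0 !prodE/=.
rewrite (@powRDn _ L (lam - 3) (lam - 2) 1 L0); last by ring.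
rewrite (@powRDn _ L (lam - 3) (lam - 1) 2 L0); last by ring.
rewrite (@powRDn _ L (lam - 3) lam 3 L0); last by ring.
have := lt0r_neq0 L0.
move: (L `^ (lam - 3)) (trace 0^'+ u) (trace L^'- u) => N d e L_neq0.
move: (d 0%N) (d 1%N) (d 2%N) (d 3%N) (e 0%N) (e 1%N) (e 2%N) (e 3%N) => *.
by field.
Qed.

(** The weak equation for the test function (L - x)^lam reads
    J' = lam/2 X - (lower-order terms) + B0, which the energy inequality
    bounds from below; Clam turns B0 into Hlam. *)
Lemma moment_derivative v0 h T v t : 0 < L -> 6 < lam ->
  weak_solution lam L v0 h T v -> 0 < t -> (t%:E < T)%E ->
  let J s := moment lam L (v ^~ s) in
  derivable J t 1 /\ (kappa lam L * J t) ^+ 2 + Hlam lam L (v ^~ t) < derive1 J t.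
Proof.
move=> L0 l6.
have lk n : (n <= 4)%N -> n%:R < lam.
  by move=> n4; apply: le_lt_trans (_ : 4 < _); [rewrite ler_nat|lra].
have l5 : 5 < lam by lra.
have l4 : 0 <= lam - 4 by lra.
have l2 : 0 <= lam - 2 by lra.
have l1 : 0 <= lam - 1 by lra.
move=> [adm weq _ _] t0 tT J.
have [dI eqI] := weq _ (C4_cutpow L l5) t t0 tT.
have -> : J = fun s => \int[mu]_(x in D) (v x s * cutpow L lam x).
  by apply/funext => s; exact: momentE.
split; first exact: dI.
have [mv v2 _ _] := adm t t0 tT.
have gap := energy_gap (u := v ^~ t) L0 l6 mv v2.
rewrite Rintegral_mul_cutpow.
have hu p : 0 <= p -> has_Rintegral L (fun x => v x t * (L - x) `^ p)
    (\int[mu]_(x in D) (v x t * (L - x) `^ p)).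
  by move=> p0; split => //; exact: (integrable_mul_powR _ _ _ p0).
have hX : has_Rintegral L (fun x => v x t ^+ 2 * (L - x) `^ (lam - 1))
   (\int[mu]_(x in D) (v x t ^+ 2 * (L - x) `^ (lam - 1))).
  by split => //; exact: (integrable_sqr_mul_powR _ _ _ l1).
have [_ E42] : has_Rintegral L
   (fun x => v x t * (derive1n 4 (cutpow L lam) x + derive1n 2 (cutpow L lam) x))
   (lam * (lam - 1) * (lam - 2) * (lam - 3) *
      \int[mu]_(x in D) (v x t * (L - x) `^ (lam - 4)) +
    lam * (lam - 1) * \int[mu]_(x in D) (v x t * (L - x) `^ (lam - 2))).
  apply: eq_has_Rintegral (has_RintegralD (has_RintegralZ _ (hu _ l4)) (has_RintegralZ _ (hu _ l2))).
  move=> x /andP[_ xL]; rewrite !derive1n_cutpow ?lk//.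
  by rewrite !(cutpow_lt _ xL) !prodE/=; ring.
have [_ E1] : has_Rintegral L (fun x => v x t ^+ 2 * derive1n 1 (cutpow L lam) x)
   (- lam * \int[mu]_(x in D) (v x t ^+ 2 * (L - x) `^ (lam - 1))).
  apply: eq_has_Rintegral (has_RintegralZ _ hX).
  move=> x /andP[_ xL]; rewrite !derive1n_cutpow ?lk//.
  by rewrite !(cutpow_lt _ xL) !prodE/=; ring.
move: eqI; rewrite E42 E1 B_cutpow// => eqI.
rewrite /Hlam; move: gap eqI.
move: (derive1 _ t) (B0 _ _ _) (Clam _ _) (kappa _ _) => dI0 b0 C k.
move: (\int[mu]_(_ in _) _) (\int[mu]_(_ in _) _) (\int[mu]_(_ in _) _) (\int[mu]_(_ in _) _).
move=> J0 X Y1 Y2. clear. lra.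
Qed.

Lemma moment_cvg0 v0 h T v : 6 < lam -> weak_solution lam L v0 h T v ->
  moment lam L (v ^~ s) @[s --> 0^'+] --> moment lam L v0.
Proof.
move=> l6.
have l5 : 5 < lam by lra.
move=> [_ _ init _].
rewrite (momentE v0) (_ : (fun s => _) = fun s => \int[mu]_(x in D) (v x s * cutpow L lam x)).
  exact: init _ (C4_cutpow L l5).
by apply/funext => s; exact: momentE.
Qed.

Lemma kappa_gt0 : 0 < L -> 6 < lam -> 0 < kappa lam L.
Proof.
move=> L0 l6; rewrite sqrtr_gt0 mulr_gt0 ?powR_gt0// divr_gt0// mulr_gt0; lra.
Qed.

End Weak.

(** * Riccati differential inequalities *)

Section Riccati.
Set Implicit Arguments.
Unset Strict Implicit.
Variables (R : realType).
Implicit Types (f : R -> R) (s t : R).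

Lemma lt_of_derive_gt0 (f : R -> R) s t : s < t ->
  (forall x, s <= x <= t -> derivable f x 1 /\ 0 < derive1 f x) -> f s < f t.
Proof.
move=> st df.
apply: (@gtr0_derive1_lt_cc _ f s t) => //; rewrite ?in_itv/= ?lexx ?ltW//.
- by move=> x; rewrite in_itv/= => /andP[sx xt]; case: (df x); rewrite ?ltW.
- by move=> x; rewrite in_itv/= => /andP[sx xt]; case: (df x); rewrite ?ltW.
- by apply: derivable_within_continuous => x; rewrite in_itv/= => /df[].
Qed.

(** The strict inequality survives the limit at 0 because it is already
    strict between t / 2 and t. *)
Lemma right_limit_lt (f : R -> R) l t : 0 < t -> f s @[s --> 0^'+] --> l ->
  (forall x, 0 < x <= t -> derivable f x 1 /\ 0 < derive1 f x) -> l < f t.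
Proof.
move=> t0 fl df.
have t20 : 0 < t / 2 by rewrite divr_gt0.
have t2t : t / 2 < t by rewrite ltr_pdivrMr// ltr_pMr// ltr1n.
have lt : f (t / 2) < f t.
  apply: lt_of_derive_gt0 => // x /andP[tx xt]; apply: df.
  by rewrite (lt_le_trans t20 tx).
apply: le_lt_trans lt; apply: (cvgr_to_le fl).
near=> s; apply/ltW/lt_of_derive_gt0.
  by near: s; exact: nbhs_right_lt.
move=> x /andP[sx xt]; apply: df; rewrite (le_trans xt (ltW t2t)) andbT.
by apply: lt_le_trans sx; near: s; exact: nbhs_right_gt.
Unshelve. all: by end_near. Qed.

Section Inequality.
Variables (J : R -> R) (k a J0 : R) (T : \bar R).
Hypotheses (k0 : 0 < k) (a0 : 0 < a) (aJ0 : a < k * J0).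
Hypothesis Jcvg : J s @[s --> 0^'+] --> J0.
Hypothesis dJ : forall t : R, 0 < t -> (t%:E < T)%E ->
  derivable J t 1 /\ (k * J t) ^+ 2 - a ^+ 2 < derive1 J t.

Let is_derive_decay (t : R) :
  is_derive t 1 (fun s => expR (- (2 * a * k) * s)) (- (2 * a * k) * expR (- (2 * a * k) * t)).
Proof.
have D1 : is_derive t 1 (fun s : R => - (2 * a * k) * s) (- (2 * a * k)).
  rewrite -[X in is_derive _ _ _ X]mulr1; exact: is_deriveZ.
have D2 := is_derive_expR (- (2 * a * k) * t).
rewrite [X in is_derive _ _ _ X]mulrC; exact: (is_derive1_comp (g := fun s : R => - (2 * a * k) * s) D2 D1).
Qed.

Let decay_cvg : expR (- (2 * a * k) * s) @[s --> 0^'+] --> (1 : R).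
Proof.
have := cvg_at_right_filter (is_derive_continuous (is_derive_decay 0)).
by rewrite mulr0 expR0.
Qed.

(** From (kJ)^2 - a^2 >= 2a(kJ - a), valid whatever the sign of kJ - a, the
    function (kJ - a) exp(-2akt) increases, so it stays above its positive
    initial value. This replaces a continuation argument. *)
Lemma riccati_gt t : 0 < t -> (t%:E < T)%E -> a < k * J t.
Proof.
move=> t0 tT.
pose z s := (k * J s - a) * expR (- (2 * a * k) * s).
have : k * J0 - a < z t.
  apply: right_limit_lt => //.
    rewrite -[X in _ --> X]mulr1; apply: cvgM => //.
    by apply: cvgB; [apply: cvgMr|exact: cvg_cst].
  move=> x /andP[x0 xt].
  have xT : (x%:E < T)%E by apply: le_lt_trans tT; rewrite lee_fin.
  have [dJx Jx] := dJ x0 xT.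
  have D1 : is_derive x 1 (fun s => k * J s - a) (k * derive1 J x).
    rewrite -[k * derive1 _ _]subr0.
    apply: is_deriveB; rewrite derive1E; apply: is_deriveZ; exact/derivableP.
  have D2 := is_deriveM D1 (is_derive_decay x).
  have zE : derive1 z x = expR (- (2 * a * k) * x) * (k * (derive1 J x - 2 * a * (k * J x - a))).
    by rewrite derive1E; have /= -> := @derive_val _ _ _ _ _ _ _ D2; rewrite /GRing.scale/=; ring.
  split; first by case: D2.
  rewrite zE mulr_gt0 ?expR_gt0// mulr_gt0//.
  have := sqr_ge0 (k * J x - a); nra.
have := expR_gt0 (- (2 * a * k) * t).
rewrite /z; set E := expR _ => E0 zt.
have : 0 < (k * J t - a) * E by apply: lt_trans zt; rewrite subr_gt0.
by rewrite pmulr_lgt0// subr_gt0.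
Qed.

(** W is constant exactly along the solutions of J' = (kJ)^2 - a^2;
    along strict supersolutions it increases strictly. *)
Let W s := (k * J s - a) / (k * J s + a) * expR (- (2 * a * k) * s).

Let dW t : 0 < t -> (t%:E < T)%E -> derivable W t 1 /\ 0 < derive1 W t.
Proof.
move=> t0 tT.
have aJ := riccati_gt t0 tT.
have [dJx Jx] := dJ t0 tT.
have P0 : 0 < k * J t + a by exact: addr_gt0 (lt_trans a0 aJ) a0.
have Pn0 := lt0r_neq0 P0.
have D1 : is_derive t 1 (fun s => k * J s - a) (k * derive1 J t).
  rewrite -[k * derive1 _ _]subr0.
  apply: is_deriveB; rewrite derive1E; apply: is_deriveZ; exact/derivableP.
have D2 : is_derive t 1 (fun s => k * J s + a) (k * derive1 J t).
  rewrite -[k * derive1 _ _]addr0.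
  apply: is_deriveD; rewrite derive1E; apply: is_deriveZ; exact/derivableP.
have D3 := is_deriveV (f := fun s => k * J s + a) Pn0 D2.
have D4 := is_deriveM (is_deriveM D1 D3) (is_derive_decay t).
have WE : derive1 W t = expR (- (2 * a * k) * t) * (2 * a * k) *
    (derive1 J t - ((k * J t) ^+ 2 - a ^+ 2)) / (k * J t + a) ^+ 2.
  rewrite derive1E; have /= -> := @derive_val _ _ _ _ _ _ _ D4.
  by rewrite !fctE /GRing.scale/=; field.
split; first by case: D4.
by rewrite WE !mulr_gt0 ?expR_gt0 ?invr_gt0 ?exprn_gt0// subr_gt0.
Qed.

Let W_incr s t : 0 < s -> s <= t -> (t%:E < T)%E -> W s <= W t.
Proof.
move=> s0; rewrite le_eqVlt => /predU1P[->//|st] tT.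
apply/ltW/lt_of_derive_gt0 => // x /andP[sx xt].
by apply: dW; [exact: lt_le_trans sx|apply: le_lt_trans tT; rewrite lee_fin].
Qed.

Lemma riccati_lower t : 0 < t -> (t%:E < T)%E -> (k * J0 - a) / (k * J0 + a) < W t.
Proof.
move=> t0 tT; apply: right_limit_lt => //.
  rewrite -[X in _ --> X]mulr1; apply: cvgM => //.
  have kJ : k * J s @[s --> 0^'+] --> k * J0 by exact: cvgMr.
  apply: cvgM; first by apply: cvgB => //; exact: cvg_cst.
  apply: cvgV; first by exact: lt0r_neq0 (addr_gt0 (lt_trans a0 aJ0) a0).
  by apply: cvgD => //; exact: cvg_cst.
move=> x /andP[x0 xt]; apply: dW => //.
by apply: le_lt_trans tT; rewrite lee_fin.
Qed.

Let W_lt t : 0 < t -> (t%:E < T)%E -> W t < expR (- (2 * a * k) * t).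
Proof.
move=> t0 tT; have aJ := riccati_gt t0 tT.
have P0 : 0 < k * J t + a by exact: addr_gt0 (lt_trans a0 aJ) a0.
rewrite /W gtr_pMl ?expR_gt0// ltr_pdivrMr// mul1r.
by have := a0; lra.
Qed.

Lemma riccati_lower_bound (c0 := (k * J0 - a) / (k * J0 + a)) t : 0 < t -> (t%:E < T)%E ->
  (1 + c0 * expR (2 * a * k * t)) / (1 - c0 * expR (2 * a * k * t)) * (a / k) <= J t.
Proof.
move=> t0 tT; have := riccati_lower t0 tT; rewrite -/c0 /W.
have aJ := riccati_gt t0 tT.
have k0' := k0; have a0' := a0.
have P0 : 0 < k * J t + a by exact: addr_gt0 (lt_trans a0 aJ) a0.
rewrite mulNr expRN ltr_pdivlMr ?expR_gt0//; set E := expR _ => c0E.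
have cE1 : 0 < 1 - c0 * E.
  by rewrite subr_gt0; apply: lt_trans c0E _; rewrite ltr_pdivrMr// mul1r; lra.
rewrite mulrAC ler_pdivrMr// mulrA ler_pdivrMr//.
by move: c0E; rewrite ltr_pdivlMr//; lra.
Qed.

(** Fix s0 in (0, T). For t >= s0 one has W s0 <= W t < exp(-2akt), hence t lies
    below the time computed from W s0. Since W s0 exceeds the initial value
    of W, that time is strictly smaller than the one computed from J0; this
    is why the bound on T is strict although T is only a supremum. *)
Lemma riccati_blowup : (0 < T)%E -> exists2 s,
  s < (2 * a * k)^-1 * ln ((k * J0 + a) / (k * J0 - a)) & (T <= s%:E)%E.
Proof.
move=> T0; have a0' := a0; have aJ0' := aJ0.
have Q0 : 0 < k * J0 + a by lra.
have q0 : 0 < k * J0 - a by lra.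
have c0 : 0 < 2 * a * k by rewrite !mulr_gt0.
have [s0 s00 s0T] : exists2 s : R, 0 < s & (s%:E < T)%E.
  move: T0; case: T => [r r0| |//].
    by exists (r / 2); [rewrite divr_gt0|rewrite lte_fin ltr_pdivrMr// ltr_pMr// ltr1n].
  by exists 1; rewrite ?ltry.
have W0 : 0 < W s0.
  by apply: lt_trans (riccati_lower s00 s0T); rewrite divr_gt0.
have bound t : 0 < t -> (t%:E < T)%E -> s0 <= t -> t < (2 * a * k)^-1 * - ln (W s0).
  move=> t0 tT s0t; rewrite ltr_pdivlMl// ltrNr -mulNr.
  have := le_lt_trans (W_incr s00 s0t tT) (W_lt t0 tT).
  by rewrite -ltr_ln ?posrE ?expR_gt0// expRK.
exists ((2 * a * k)^-1 * - ln (W s0)).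
  rewrite ltr_pM2l ?invr_gt0// ltrNl -lnV ?posrE ?divr_gt0// invf_div.
  by rewrite ltr_ln ?posrE ?divr_gt0//; exact: riccati_lower.
have b0 := bound _ s00 s0T (lexx _).
rewrite leNgt; apply/negP => bT.
have := bound _ (lt_trans s00 b0) bT (ltW b0); by rewrite ltxx.
Qed.

End Inequality.
End Riccati.

(** * Finite-time blow-up *)

Theorem theorem3p3 (R : realType) (L lam a : R) (v0 h : R -> R) (v : R -> R -> R)
  (L_gt0 : 0 < L) (lam_gt6 : 6 < lam) (a_gt0 : 0 < a)
  (v0_int : (@lebesgue_measure R).-integrable `]0, L[ (fun x => (v0 x)%:E))
  (v_sol : exists2 T : \bar R, (0 < T)%E & weak_solution lam L v0 h T v)
  (H_ge : forall t : R, 0 < t -> (t%:E < blowup_time lam L v0 h v)%E ->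
     - a ^+ 2 <= Hlam lam L (v ^~ t))
  (J0_gt : a / kappa lam L < moment lam L v0) :
  let k := kappa lam L in
  let J0 := moment lam L v0 in
  let J t := moment lam L (v ^~ t) in
  let c0 := (k * J0 - a) / (k * J0 + a) in
  [/\ ~ weak_solution lam L v0 h +oo%E v,
      ~ (exists2 w : R -> R -> R, weak_solution lam L v0 h +oo%E w &
           forall t : R, 0 < t -> - a ^+ 2 <= Hlam lam L (w ^~ t)),
      forall t : R, 0 < t -> (t%:E < blowup_time lam L v0 h v)%E ->
        (1 + c0 * expR (2 * a * k * t)) / (1 - c0 * expR (2 * a * k * t)) * (a / k)
        <= J t
    & (blowup_time lam L v0 h v <
       ((2 * a * k)^-1 * ln ((k * J0 + a) / (k * J0 - a)))%:E)%E].
Proof.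
move=> k J0 J c0.
have k0 : 0 < k by exact: kappa_gt0.
have aJ0 : a < k * J0 by rewrite mulrC -ltr_pdivrMr.
have riccati w t T : weak_solution lam L v0 h T w -> 0 < t -> (t%:E < T)%E ->
    - a ^+ 2 <= Hlam lam L (w ^~ t) ->
    derivable (fun s => moment lam L (w ^~ s)) t 1 /\
    (k * moment lam L (w ^~ t)) ^+ 2 - a ^+ 2 < derive1 (fun s => moment lam L (w ^~ s)) t.
  move=> w_sol t0 tT Hw.
  have [dJ J'] := moment_derivative L_gt0 lam_gt6 w_sol t0 tT.
  by split => //; apply: le_lt_trans J'; rewrite lerD2l.
(* The Riccati inequality holds up to the blow-up time, since every earlier
   time lies in the lifespan of some solution in the supremum. *)
set Tv := blowup_time lam L v0 h v.
have [T1 T1_gt0 v_sol1] := v_sol.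
have Tv_gt0 : (0 < Tv)%E.
  by apply: (lt_le_trans T1_gt0); apply: ereal_sup_ubound.
have J_cvg : J s @[s --> 0^'+] --> J0 := moment_cvg0 lam_gt6 v_sol1.
have dJ t : 0 < t -> (t%:E < Tv)%E ->
    derivable J t 1 /\ (k * J t) ^+ 2 - a ^+ 2 < derive1 J t.
  move=> t0 tTv; have [T [_ v_solT] tT] := ereal_sup_gt tTv.
  by apply: (riccati v t T) => //; exact: H_ge.
have [s s_lt Tv_le] := riccati_blowup k0 a_gt0 aJ0 J_cvg dJ Tv_gt0.
have blowup_lt : (Tv < ((2 * a * k)^-1 * ln ((k * J0 + a) / (k * J0 - a)))%:E)%E.
  by apply: (le_lt_trans Tv_le); rewrite lte_fin.
split => //.
- move=> v_soly; have : (+oo <= Tv)%E by apply: ereal_sup_ubound; split.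
  by rewrite leye_eq => /eqP TvE; move: Tv_le; rewrite TvE.
- move=> [w w_sol Hw].
  have [] := riccati_blowup k0 a_gt0 aJ0 (moment_cvg0 lam_gt6 w_sol) (T := +oo%E) => //.
  by move=> t t0 ty; apply: (riccati w t +oo%E) => //; exact: Hw.
- by move=> t; exact: riccati_lower_bound.
Qed.
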